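(* Let $(X,d)$ be a compact metric space, $f_{0,\infty}=\{f_n\}_{n=0}^\infty$ a sequence of continuous self-maps of $X$, and $A\in\mathcal{S}$. Then $h_A(f_{0,\infty})=0$ if and only if $h_A(\hat{f}_{0,\infty})=0$. Consequently, $(X,f_{0,\infty})$ is null if and only if $(\mathcal{M}(X),\hat f_{0,\infty})$ is null.
   Context: $f_0^n=f_{n-1}\circ\cdots\circ f_0$, $f_0^0=\mathrm{id}$. $\mathcal S$ is the set of strictly increasing sequences $A=\{a_i\}_{i\ge1}$ of nonnegative integers. For a compact metric space $Z$ and continuous self-maps $g_{0,\infty}$ of $Z$, $h_A(g_{0,\infty})=\sup_{\mathscr A}\limsup_{n\to\infty}\frac1n\log\mathcal N(\bigvee_{i=1}^n (g_0^{a_i})^{-1}\mathscr A)$ over finite open covers $\mathscr A$ of $Z$ ($\bigvee$ = common refinement, $\mathcal N$ = minimal cardinality of a subcover). $\mathcal M(X)$ is the space of Borel probability measures on $X$ with the weak$^*$ topology (a compact metric space, e.g. with the Prohorov metric $\mathcal P_d(\mu,\nu)=\inf\{\epsilon>0:\mu(B)\le\nu(B^\epsilon)+\epsilon\ \forall B \text{ Borel}\}$, $B^\epsilon=\{x:d(x,B)<\epsilon\}$), and $\hat f_{0,\infty}=\{\hat f_n\}$ with $\hat f_n(\mu)(B)=\mu(f_n^{-1}(B))$; each $\hat f_n$ is continuous. A system is null if $h_A=0$ for every $A\in\mathcal S$. *)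

(* Defs.v *)
From HB Require Import structures.
From mathcomp Require Import all_boot all_order all_algebra.
From mathcomp Require Import all_classical all_reals all_analysis.

Set Implicit Arguments.
Unset Strict Implicit.
Unset Printing Implicit Defensive.

Import Order.TTheory GRing.Theory Num.Theory.
Import numFieldNormedType.Exports.

Local Open Scope classical_set_scope.
Local Open Scope ring_scope.

Fixpoint comp0n {Z : Type} (g : nat -> Z -> Z) (n : nat) : Z -> Z :=
  match n with
  | 0 => id
  | n.+1 => g n \o comp0n g n
  end.

(* A in S: strictly increasing sequences of nonnegative integers.
   The paper writes A = {a_i}_{i>=1}; we index from 0, i.e. a i = a_{i+1}. *)
Definition strictly_increasing (a : nat -> nat) : Prop :=
  forall i, (a i < a i.+1)%N.

(* Topological sequence entropy along A, relative to a family `op` of open   *)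
(* subsets of the space Z (so that it can be used both for the topology of X *)
(* and for the weak* (Prohorov-metric) topology of M(X)).                    *)

Definition finite_open_cover {Z : Type} (op : set (set Z)) (C : set (set Z)) :=
  [/\ finite_set C, C `<=` op & \bigcup_(U in C) U = [set: Z]].

Definition Ncov {R : realType} {Z : Type} (F : set (set Z)) : R :=
  inf [set (size s)%:R | s in
        [set s : seq (set Z) | (forall U, U \in s -> F U) /\
                               [set: Z] `<=` \bigcup_(U in [set U | U \in s]) U]].

Definition join_pre {Z : Type} (g : nat -> Z -> Z) (a : nat -> nat)
    (n : nat) (C : set (set Z)) : set (set Z) :=
  [set V | exists s : nat -> set Z,
     (forall i, (i < n)%N -> C (s i)) /\
     V = \bigcap_(i in [set i | (i < n)%N]) (comp0n g (a i) @^-1` s i)].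

Definition seq_entropy {R : realType} {Z : Type} (op : set (set Z))
    (g : nat -> Z -> Z) (a : nat -> nat) : \bar R :=
  ereal_sup [set limn_esup
      (fun n => ((n%:R)^-1 * ln (@Ncov R Z (join_pre g a n C)))%:E)
    | C in finite_open_cover op].

Definition null_system {R : realType} {Z : Type} (op : set (set Z))
    (g : nat -> Z -> Z) : Prop :=
  forall a, strictly_increasing a -> @seq_entropy R Z op g a = 0%E.

(* A measure is a real-valued set function; it is normalized to 0 on        *)
(* non-Borel sets, so that elements of M(X) are exactly the Borel            *)
(* probability measures.                                                    *)
Definition borel {X : topologicalType} : set (set X) := <<s @open X >>.

Record bprob (R : realType) (X : topologicalType) := BProb {
  bp_mu :> set X -> R ;
  bp_nonborel : forall B, ~ borel B -> bp_mu B = 0 ;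
  bp_ge0 : forall B, 0 <= bp_mu B ;
  bp_setT : bp_mu [set: X] = 1 ;
  bp_sigma_additive : forall F : nat -> set X,
      (forall i, borel (F i)) -> trivIset [set: nat] F ->
      (fun n => \sum_(0 <= i < n) bp_mu (F i)) @ \oo --> bp_mu (\bigcup_i F i)
}.

Lemma continuous_borel_preimage (X : topologicalType) (f : X -> X) :
  continuous f -> forall B, borel B -> borel (f @^-1` B).
Proof.
move=> cf B; rewrite /borel.
have : <<s @open X >> `<=` [set B | <<s @open X >> (f @^-1` B)].
  apply: smallest_sub.
  - split.
    + by rewrite /= preimage_set0; exact: sigma_algebra0.
    + move=> A /= hA; rewrite setTD preimage_setC -setTD.
      exact: sigma_algebraCD.
    + move=> F hF; rewrite /= preimage_bigcup.
      exact: sigma_algebra_bigcup.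
  - move=> U oU /=; apply: sub_gen_smallest.
    exact: open_comp.
by apply.
Qed.

Section push.
Context {R : realType} {X : topologicalType} (f : X -> X) (cf : continuous f).

Let pmu (mu : bprob R X) : set X -> R :=
  fun B => if pselect (borel B) then mu (f @^-1` B) else 0.

Let pmu_nonborel mu B : ~ borel B -> pmu mu B = 0.
Proof. by move=> nB; rewrite /pmu; case: pselect. Qed.

Let pmu_ge0 mu B : 0 <= pmu mu B.
Proof. rewrite /pmu; case: pselect => [?|?]; [exact: bp_ge0|exact: lexx]. Qed.

Let pmu_setT mu : pmu mu [set: X] = 1.
Proof.
rewrite /pmu; case: pselect => [?|]; first by rewrite preimage_setT bp_setT.
by move=> []; rewrite -[X in borel X]setD0; apply: sigma_algebraCD;
  exact: sigma_algebra0.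
Qed.

Let pmu_sigma_additive mu (F : nat -> set X) :
  (forall i, borel (F i)) -> trivIset [set: nat] F ->
  (fun n => \sum_(0 <= i < n) pmu mu (F i)) @ \oo --> pmu mu (\bigcup_i F i).
Proof.
move=> bF tF.
have bU : borel (\bigcup_i F i) by exact: sigma_algebra_bigcup.
rewrite /pmu; case: pselect => // ?.
have -> : (fun n => \sum_(0 <= i < n) (if pselect (borel (F i))
      then mu (f @^-1` F i) else 0)) =
    (fun n => \sum_(0 <= i < n) mu (f @^-1` F i)).
  by apply: funext => n; apply: eq_bigr => i _; case: pselect.
rewrite preimage_bigcup; apply: bp_sigma_additive.
- by move=> i; exact: continuous_borel_preimage.
- apply/trivIsetP => i j _ _ ij; rewrite -preimage_setI.
  by move/trivIsetP : tF => /(_ _ _ I I ij) ->; rewrite preimage_set0.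
Qed.

Definition push (mu : bprob R X) : bprob R X :=
  @BProb R X (pmu mu) (@pmu_nonborel mu) (@pmu_ge0 mu) (@pmu_setT mu)
    (@pmu_sigma_additive mu).

End push.

Definition hat_seq {R : realType} {X : topologicalType} (f : nat -> X -> X)
    (cf : forall n, continuous (f n)) : nat -> bprob R X -> bprob R X :=
  fun n => push (cf n).

(* Weak* topology on M(X), via the Prohorov metric                          *)
Definition eps_nbhd {R : realType} {X : metricType R} (B : set X) (e : R)
  : set X := [set x | exists2 y, B y & mdist x y < e].

Definition prohorov {R : realType} {X : metricType R} (mu nu : bprob R X) : R :=
  inf [set e : R | 0 < e /\
         forall B : set X, borel B -> mu B <= nu (eps_nbhd B e) + e].

Definition prohorov_open {R : realType} {X : metricType R} :
    set (set (bprob R X)) :=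
  [set U | forall mu, U mu -> exists2 e : R, 0 < e &
             [set nu | prohorov mu nu < e] `<=` U].

(* Main.v *)
(* One direction pulls open covers of M(X) back to X along x |-> delta_x, an open
   cover {U} of X being turned into the cover {mu : mu(U) > c} of M(X).
   For the other, let the n-th join of a fine cover of X have a subcover by
   m = exp(o(n)) sets, made disjoint. Up to a small Prohorov error, the n
   push-forwards of mu are the distributions of the colours seen by the m pieces,
   i.e. a convex combination, weighted by mu, of m vectors with 0/1 entries, n times
   boundedly many coordinates each. Averaging k of these vectors (Maurey sampling)
   reproduces this combination with mean-square error O(1/k) per coordinate, so after
   rounding only O(n/k) coordinates need a correction. There are m^k samples and
   exp(o(1) n) corrections as k grows, which bounds the number of distinguishable
   measures. The cover of M(X) has a Lebesgue number by compactness of M(X): an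
   ultrafilter limit of measures is finitely additive, and it is regularized to a
   Borel measure by Caratheodory's method. *)
Require Import Defs.
From HB Require Import structures.
From mathcomp Require Import all_boot all_order all_algebra.
From mathcomp Require Import all_classical all_reals all_analysis.
From mathcomp Require Import ring lra.

Import Order.TTheory GRing.Theory Num.Theory.
Import numFieldNormedType.Exports.
Local Open Scope classical_set_scope.
Local Open Scope ring_scope.
Set Implicit Arguments.
Unset Strict Implicit.
Unset Printing Implicit Defensive.

(** * Subcovers and growth rates *)

Section subcovers.
Context {R : realType} {Z : Type}.
Implicit Types (F C : set (set Z)) (s : seq (set Z)).

Definition subcover F s :=
  (forall U, U \in s -> F U) /\
  [set: Z] `<=` \bigcup_(U in [set U | U \in s]) U.

Lemma has_lbound_subcover_size F :
  has_lbound [set ((size s)%:R : R) | s in subcover F].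
Proof. by exists 0 => _ [s _ <-]. Qed.

Lemma Ncov_le_size F s : subcover F s -> Ncov F <= (size s)%:R :> R.
Proof. by move=> Fs; apply: ge_inf; [exact: has_lbound_subcover_size|exists s]. Qed.

Lemma exists_subcover_size_lt F : subcover F !=set0 ->
  exists2 s, subcover F s & (size s)%:R < Ncov F + 1 :> R.
Proof.
move=> [s0 Fs0]; have [|_ [s Fs <-] hs] := @inf_adherent R
    [set ((size s)%:R : R) | s in subcover F] 1 ltr01.
  by split; [exists (size s0)%:R, s0|exact: has_lbound_subcover_size].
by exists s.
Qed.

(** Two degenerate cases rest on [ln] being 0 at nonpositive arguments: without a subcover the
    infimum of the empty set is 0, and an empty space is covered by the empty list. Otherwise every
    subcover has at least one member. *)
Lemma ln_Ncov_ge0 F : 0 <= ln (@Ncov R Z F).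
Proof.
have [[s Fs]|/nonemptyPn F0] := pselect (subcover F !=set0); last first.
  by rewrite /Ncov -/(subcover F) F0 image_set0 inf0 ln0.
have [Fnil|Fnil] := pselect (subcover F [::]).
  by rewrite ln0// (le_trans (Ncov_le_size Fnil)).
apply/ln_ge0/lb_le_inf; first by exists (size s)%:R, s.
by move=> _ [[|U t] Ft <-] //; rewrite ler1n.
Qed.

(* A finite-valued coding of the points of [Z] whose nonempty fibres each lie in
   a member of [F] yields a subcover with at most as many members as codes. *)
Lemma subcover_of_coding F (T : finType) (code : Z -> T) (A : {set T}) :
  (forall z, code z \in A) ->
  (forall z, exists2 U, F U & forall z', code z' = code z -> U z') ->
  exists2 s, subcover F s & (size s <= #|A|)%N.
Proof.
move=> codeA codeF.
have /choice [U UP] : forall t : T, exists U, (exists z, code z = t) ->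
    F U /\ forall z', code z' = t -> U z'.
  move=> t; have [[z <-]|nt] := pselect (exists z, code z = t); last by exists set0.
  by have [U FU Uz] := codeF z; exists U.
pose P t := `[< exists z, code z = t >].
exists [seq U t | t <- enum [pred t in A | P t]].
  split=> [V /mapP [t]|z _].
    by rewrite mem_enum inE => /andP[_ /asboolP /UP[]] + _ ->.
  have zP : exists z', code z' = code z by exists z.
  exists (U (code z)); last exact: (UP _ zP).2.
  by apply: map_f; rewrite mem_enum inE codeA; exact/asboolP.
rewrite size_map -cardE; apply: subset_leq_card; apply/fintype.subsetP => t.
by rewrite inE => /andP[].
Qed.

(** This rules out the value 0 that [Ncov] takes on a family without subcovers. Points are coded by
    the indices of the members of [C] visited at the [n] times. *)
Lemma subcover_join_pre (op : set (set Z)) C g a n :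
  finite_open_cover op C -> subcover (join_pre g a n C) !=set0.
Proof.
move=> [/finite_seqP[c ->] _ CT].
have cell z : exists i, (i < size c)%N /\ nth set0 c i z.
  have : [set: Z] z by []; rewrite -CT => -[U /= Uc Uz].
  by exists (index U c); rewrite index_mem nth_index.
have /choice[r rP] := cell.
pose code (z : Z) : {ffun 'I_n -> 'I_(size c)} :=
  [ffun i : 'I_n => Ordinal (rP (comp0n g (a i) z)).1].
have [z|z|s ? _] := @subcover_of_coding (join_pre g a n [set` c]) _ code finset.setT.
- by rewrite inE.
- exists (\bigcap_(i in [set i | (i < n)%N])
      (comp0n g (a i) @^-1` (nth set0 c (r (comp0n g (a i) z))))).
    exists (fun i => nth set0 c (r (comp0n g (a i) z))); split=> // i _ /=.
    by rewrite mem_nth// (rP _).1.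
  move=> z' /ffunP zz' i /= ni.
  have /(congr1 val) := zz' (Ordinal ni); rewrite !ffunE /= => <-.
  exact: (rP _).2.
- by exists s.
Qed.

End subcovers.

Section growth.
Context {R : realType} {Z : Type} (op : set (set Z)) (g : nat -> Z -> Z)
  (a : nat -> nat).
Hypothesis opT : op [set: Z].

Let rate C n : R := n%:R^-1 * ln (Ncov (join_pre g a n C)).

Let rate_ge0 C n : (0 <= (rate C n)%:E)%E.
Proof. by rewrite lee_fin mulr_ge0// ?invr_ge0// ln_Ncov_ge0. Qed.

Let limn_esup_rate_ge0 C : (0 <= limn_esup (fun n => (rate C n)%:E))%E.
Proof. by apply: limf_esup_ge0 => // -[n _] /(_ n) /=; rewrite leqnn; exact. Qed.

(** Zero entropy is subexponential growth of the joins; both directions of the theorem work with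
    this form only. *)
Lemma seq_entropy_eq0P : @seq_entropy R Z op g a = 0%E <->
  forall C, finite_open_cover op C -> forall b : R, 0 < b ->
    exists N, forall n, (N <= n)%N -> Ncov (join_pre g a n C) <= expR (b * n%:R) :> R.
Proof.
split=> [h0 C opC b b0|H].
  have /(ereal_inf_lt) : (limn_esup (fun n => (rate C n)%:E) < b%:E)%E.
    by apply: (@le_lt_trans _ _ 0%E); rewrite ?lte_fin// -h0;
      apply: ereal_sup_ubound; exists C.
  (* Starting at [N.+1] makes [n] positive, so that the factor [n^-1] can be cleared. *)
  move=> [_ [V [N _ NV] <-] supV]; exists N.+1 => n Nn.
  have n0 : (0 < n)%N by exact: leq_trans Nn.
  have : ((rate C n)%:E < b%:E)%E.
    apply: le_lt_trans supV; apply: ereal_sup_ubound; exists n => //.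
    by apply: NV => /=; exact: ltnW.
  rewrite lte_fin /rate mulrC ltr_pdivrMr ?ltr0n// => /ltW.
  have [N0 _|N0] := leP (Ncov (join_pre g a n C)) (0 : R).
    by rewrite (le_trans N0)// expR_ge0.
  by move=> lnN; rewrite -(lnK N0) ler_expR.
apply/eqP; rewrite eq_le; apply/andP; split; last first.
  (* The one-member cover keeps the supremum from being taken over the empty set; its rates are
     nonnegative. *)
  apply: (@le_trans _ _ (limn_esup (fun n => (rate [set setT] n)%:E))) => //.
  apply: ereal_sup_ubound; exists [set setT] => //.
  by split; [exact: finite_set1|move=> _ ->|rewrite bigcup_set1].
apply: ge_ereal_sup => _ [C opC <-]; apply/lee_addgt0Pr => b b0; rewrite add0e.
have [N NP] := H C opC b b0.
apply: (@le_trans _ _ (ereal_sup [set (rate C n)%:E | n in [set n | (N <= n)%N]])).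
  by apply: ereal_inf_lbound; exists [set n | (N <= n)%N] => //; exists N.
apply: ge_ereal_sup => _ [n /= Nn <-]; rewrite lee_fin /rate.
have [->|n0] := eqVneq n 0%N; first by rewrite invr0 mul0r ltW.
rewrite mulrC ler_pdivrMr ?ltr0n ?lt0n//.
have [N0|N0] := leP (Ncov (join_pre g a n C)) (0 : R).
  by rewrite ln0// mulr_ge0// ltW.
by rewrite -ler_expR lnK//; exact: NP.
Qed.

End growth.

(** * Borel probability measures and the Prohorov topology *)

Section borel_sets.
Context {X : topologicalType}.
Implicit Types A B : set X.

Lemma borel_open A : open A -> borel A.
Proof. by move=> oA; exact: sub_gen_smallest. Qed.

Lemma borel0 : borel (@set0 X).
Proof. exact: sigma_algebra0. Qed.

Lemma borelC A : borel A -> borel (~` A).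
Proof. by move=> bA; rewrite -setTD; exact: sigma_algebraCD. Qed.

Lemma borel_closed A : closed A -> borel A.
Proof. by move=> cA; rewrite -[A]setCK; exact: borelC (borel_open (closed_openC cA)). Qed.

Lemma borelT : borel [set: X].
Proof. by rewrite -setC0; exact: borelC borel0. Qed.

Lemma borel_bigcup (F : (set X)^nat) : (forall i, borel (F i)) -> borel (\bigcup_i F i).
Proof. exact: sigma_algebra_bigcup. Qed.

Lemma borelU A B : borel A -> borel B -> borel (A `|` B).
Proof.
move=> bA bB; rewrite -bigcup2E; apply: borel_bigcup => -[|[|i]] //=.
exact: borel0.
Qed.

Lemma borelI A B : borel A -> borel B -> borel (A `&` B).
Proof.
by move=> bA bB; rewrite -[A]setCK -[B]setCK -setCU; exact: borelC (borelU (borelC bA) (borelC bB)).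
Qed.

Lemma borelD A B : borel A -> borel B -> borel (A `\` B).
Proof. by move=> bA bB; rewrite setDE; exact: borelI bA (borelC bB). Qed.

Lemma borel_bigsetU I (s : seq I) (P : pred I) (F : I -> set X) :
  (forall i, borel (F i)) -> borel (\big[setU/set0]_(i <- s | P i) F i).
Proof. by move=> bF; elim/big_ind : _ => //; [exact: borel0|exact: borelU]. Qed.

End borel_sets.

Section bprob_theory.
Context {R : realType} {X : topologicalType} (mu : bprob R X).
Implicit Types A B : set X.

(** Additivity along the constant sequence of empty sets makes a series with constant term converge,
    so the term is 0. *)
Lemma bprob_set0 : mu set0 = 0.
Proof.
have := @bp_sigma_additive _ _ mu (fun=> set0) (fun=> borel0) (@trivIset_set0 _ _ _).
move=> /cvgP /cvg_series_cvg_0 /= /cvg_lim h.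
by rewrite -[RHS]h// lim_cst.
Qed.

Lemma bprobU A B : borel A -> borel B -> A `&` B = set0 -> mu (A `|` B) = mu A + mu B.
Proof.
move=> bA bB AB0.
have bF i : borel (bigcup2 A B i) by case: i => [|[|i]] //=; exact: borel0.
have tF : trivIset setT (bigcup2 A B) by rewrite -trivIset_bigcup2.
have := @bp_sigma_additive _ _ mu _ bF tF; rewrite bigcup2E => /cvg_lim <- //.
apply: lim_near_cst => //; near=> n.
have n2 : (2 <= n)%N by near: n; exact: nbhs_infty_ge.
rewrite -(subnKC n2) big_nat_recl// big_nat_recl// big1 ?addr0// => i _ /=.
exact: bprob_set0.
Unshelve. all: by end_near. Qed.

Lemma bprobD A B : borel A -> borel B -> B `<=` A -> mu (A `\` B) = mu A - mu B.
Proof.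
move=> bA bB BA; have := bprobU bB (borelD bA bB).
rewrite setDUK// => ->; first by rewrite addrC addKr.
by rewrite setDE setIC -setIA setICl setI0.
Qed.

Lemma le_bprob A B : borel A -> borel B -> A `<=` B -> mu A <= mu B.
Proof. by move=> bA bB AB; rewrite -subr_ge0 -bprobD// bp_ge0. Qed.

Lemma bprob_le1 A : mu A <= 1.
Proof.
have [bA|nA] := pselect (borel A); last by rewrite bp_nonborel.
by rewrite -(bp_setT mu); apply: le_bprob => //; exact: borelT.
Qed.

Lemma bprobC A : borel A -> mu (~` A) = 1 - mu A.
Proof. by move=> bA; rewrite -setTD bprobD ?bp_setT//; exact: borelT. Qed.

Lemma bprobU_le A B : borel A -> borel B -> mu (A `|` B) <= mu A + mu B.
Proof.
move=> bA bB; have bU := borelU bA bB.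
rewrite -(setDUK (@subsetUl _ A B)) bprobU ?lerD2l ?le_bprob//.
- exact: borelD.
- by move=> x [[]].
- exact: borelD.
- by rewrite setDE setIC -setIA setICl setI0.
Qed.

Lemma bprob_bigsetU (I : choiceType) (s : seq I) (P : pred I) (F : I -> set X) :
  uniq s -> (forall i, borel (F i)) -> trivIset setT F ->
  mu (\big[setU/set0]_(i <- s | P i) F i) = \sum_(i <- s | P i) mu (F i).
Proof.
move=> us bF tF; elim: s us => [_|i s ih /= /andP[si us]].
  by rewrite !big_nil bprob_set0.
rewrite !big_cons; case: ifPn => Pi; last exact: ih.
rewrite bprobU ?ih//; first exact: borel_bigsetU.
rewrite -subset0 -bigcup_seq_cond => x [Fix [j /= /andP[js _] Fjx]].
suff ij : i = j by move: si; rewrite ij js.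
by apply: tF => //; exists x.
Qed.

Lemma bprob_bigsetU_le (I : Type) (s : seq I) (F : I -> set X) :
  (forall i, borel (F i)) ->
  mu (\big[setU/set0]_(i <- s) F i) <= \sum_(i <- s) mu (F i).
Proof.
move=> bF; elim: s => [|i s ih]; first by rewrite !big_nil bprob_set0.
rewrite !big_cons (le_trans (bprobU_le _ _))// ?lerD2l//.
exact: borel_bigsetU.
Qed.

Lemma bprob_cvg_nondecreasing (F : (set X)^nat) :
  (forall i, borel (F i)) -> (forall n, F n `<=` F n.+1) ->
  mu \o F @ \oo --> mu (\bigcup_i F i).
Proof.
move=> bF ndF.
have ndF' : {homo F : n m / (n <= m)%N >-> (n <= m)%O}.
  by apply: homo_leq => //; [move=> ? ? ?; exact: le_trans|move=> n; exact/subsetPset].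
have bD i : borel (seqD F i) by case: i => [|i] //=; exact: borelD.
have -> : mu \o F = fun n => \sum_(0 <= i < n.+1) mu (seqD F i).
  apply/funext => n /=; elim: n => [|n ih]; first by rewrite big_nat1.
  by rewrite big_nat_recr//= -ih bprobD// addrC subrK.
rewrite -eq_bigcup_seqD.
rewrite (cvg_shiftS (fun n => \sum_(0 <= i < n) mu (seqD F i))).
by apply: bp_sigma_additive => //; exact: trivIset_seqD.
Qed.

End bprob_theory.

(** A subcover of [F'] pulls back along [d] to one of [F] of the same size. Some subcover of [F']
    must exist, lest its [Ncov] be 0 by default. *)
Lemma le_Ncov (R : realType) (Z Z' : Type) (d : Z -> Z') (F : set (set Z))
    (F' : set (set Z')) :
  (forall V, F' V -> exists2 W, F W & d @^-1` V `<=` W) ->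
  subcover F' !=set0 -> Ncov F <= Ncov F' :> R.
Proof.
move=> F'F [s0 F's0].
have /choice[w wP] : forall V, exists W, F' V -> F W /\ d @^-1` V `<=` W.
  move=> V; have [/F'F[W FW VW]|] := pselect (F' V); first by exists W.
  by exists set0.
apply: lb_le_inf; first by exists (size s0)%:R, s0.
move=> _ [s [sF' sT] <-]; rewrite -(size_map w); apply: Ncov_le_size; split.
  by move=> _ /mapP[V /sF'/wP[FW _] ->].
move=> z _; have [V /= sV Vz] := sT (d z) I.
exists (w V); first exact: map_f.
by apply: (wP V (sF' _ sV)).2.
Qed.

Section metric.
Context {R : realType} {X : metricType R}.
Implicit Types (B U : set X) (mu nu : bprob R X) (e : R).

Lemma open_eps_nbhd B e : open (eps_nbhd B e).
Proof.
rewrite openE => x [y By xy]; apply/nbhs_ballP.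
exists (e - mdist x y); rewrite /= ?subr_gt0// => z.
rewrite ballEmdist/= => xz; exists y => //.
rewrite (le_lt_trans (metric_triangle z x y))// metric_sym -ltrBrDr//.
Qed.

Lemma borel_eps_nbhd B e : borel (eps_nbhd B e).
Proof. exact: borel_open (open_eps_nbhd B e). Qed.

Lemma sub_eps_nbhd B e : 0 < e -> B `<=` eps_nbhd B e.
Proof. by move=> e0 x Bx; exists x; rewrite ?mdistxx. Qed.

Lemma le_eps_nbhd B e e' : e <= e' -> eps_nbhd B e `<=` eps_nbhd B e'.
Proof. by move=> ee' x [y By xy]; exists y => //; exact: lt_le_trans ee'. Qed.

Lemma prohorov_ltP mu nu e : prohorov mu nu < e <-> exists e', [/\ 0 < e', e' < e &
  forall B, borel B -> mu B <= nu (eps_nbhd B e') + e'].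
Proof.
set E := [set e' : R | 0 < e' /\ forall B, borel B -> mu B <= nu (eps_nbhd B e') + e'].
have lE : has_lbound E by exists 0 => e' [/ltW].
have E1 : E 1.
  by split=> // B _; rewrite (le_trans (bprob_le1 mu B))// lerDr bp_ge0.
split=> [|[e' [e'0 e'e e'P]]]; last by apply: le_lt_trans e'e; exact: ge_inf.
move=> /inf_lt; case; first by exists 1.
by move=> e' [e'0 e'P] e'e; exists e'.
Qed.

Lemma prohorov_openT : @prohorov_open R X setT.
Proof. by move=> mu _; exists 1. Qed.

(** Lower semicontinuity of the mass of an open set: [U] is exhausted by the sets [F n] of points at
    distance at least [1/(n+1)] from its complement, and one of these already has mass above [c]. *)
Lemma prohorov_open_mass U (c : R) : open U ->
  prohorov_open [set mu : bprob R X | c < mu U].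
Proof.
move=> oU mu /= cU.
pose F n := ~` eps_nbhd (~` U) n.+1%:R^-1.
have bF n : borel (F n) by exact: borelC (borel_eps_nbhd _ _).
have ndF n : F n `<=` F n.+1.
  by apply: subsetC; apply: le_eps_nbhd; rewrite lef_pV2 ?posrE// ler_nat.
have UF : U = \bigcup_n F n.
  apply/seteqP; split=> x.
    move: oU; rewrite openE => /[apply] /nbhs_ballP[e e0 xU].
    have [n ne] := @ltr_add_invr R 0 e e0.
    exists n => // -[y nUy xy]; apply/nUy/xU; rewrite ballEmdist/=.
    by rewrite (lt_trans xy)// -[X in X < _]add0r.
  move=> [n _ nx]; apply: contrapT => nUx; apply: nx; exists x => //.
  by rewrite mdistxx.
have := @bprob_cvg_nondecreasing _ _ mu _ bF ndF; rewrite -UF => Fmu.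
have [N _ NP] : \forall n \near \oo, c < mu (F n).
  exact: (cvgr_gt (mu U)).
have cN := NP N (leqnn N).
(* The first bound keeps the neighbourhood of [F N] inside [U], the second absorbs the additive
   error of the Prohorov inequality. *)
exists (Num.min N.+1%:R^-1 (mu (F N) - c)).
  by rewrite lt_min invr_gt0 ltr0n subr_gt0 cN.
move=> nu /= /prohorov_ltP[e [e0]]; rewrite lt_min => /andP[eN ec] /(_ _ (bF N)) mn.
have : nu (eps_nbhd (F N) e) <= nu U.
  apply: le_bprob; [exact: borel_eps_nbhd|exact: borel_open|].
  move=> y [x Fx yx]; apply: contrapT => nUy; apply: Fx; exists y => //.
  by rewrite metric_sym (lt_trans yx).
by move: mn ec; lra.
Qed.

End metric.

(** * Point masses, iterates, and the descent of zero entropy to the base system *)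

Section dirac.
Context {R : realType} {X : topologicalType} (x : X).

Let dirac_fun (B : set X) : R := (`[< borel B /\ B x >])%:R.

Let dirac_nonborel B : ~ borel B -> dirac_fun B = 0.
Proof. by move=> nB; rewrite /dirac_fun asboolF// => -[]. Qed.

Let dirac_ge0 B : 0 <= dirac_fun B.
Proof. by rewrite ler0n. Qed.

Let dirac_setT : dirac_fun setT = 1.
Proof. by rewrite /dirac_fun asboolT//; split => //; exact: borelT. Qed.

Let dirac_sigma_additive (F : nat -> set X) :
  (forall i, borel (F i)) -> trivIset [set: nat] F ->
  (fun n => \sum_(0 <= i < n) dirac_fun (F i)) @ \oo --> dirac_fun (\bigcup_i F i).
Proof.
move=> bF tF; rewrite /dirac_fun.
have [[k _ Fk]|nF] := pselect ((\bigcup_i F i) x); last first.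
  rewrite asboolF; last by move=> [_ ?]; exact: nF.
  rewrite (_ : (fun _ => _) = cst 0); first exact: cvg_cst.
  apply/funext => n; rewrite big1// => i _; rewrite asboolF// => -[_ Fi].
  by apply: nF; exists i.
rewrite asboolT; last by split; [exact: borel_bigcup|exists k].
apply: cvg_near_cst; near=> n.
have kn : (k < n)%N by near: n; exact: nbhs_infty_gt.
rewrite (bigD1_seq k) ?mem_index_iota ?iota_uniq//= asboolT ?big1 ?addr0//.
move=> i ik; rewrite asboolF// => -[_ Fi]; move/eqP: ik; apply.
by apply: tF => //; exists x.
Unshelve. all: by end_near. Qed.

Definition dirac_bprob : bprob R X :=
  BProb dirac_nonborel dirac_ge0 dirac_setT dirac_sigma_additive.

Lemma dirac_bprob_gt0 B : 0 < dirac_bprob B -> B x.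
Proof. by rewrite /= /dirac_fun; case: asboolP => [[]|]; rewrite ?ltxx. Qed.

End dirac.

Section iterates.
Context {R : realType} {X : topologicalType} (f : nat -> X -> X).
Hypothesis cf : forall n, continuous (f n).

Lemma continuous_comp0n n : continuous (comp0n f n).
Proof.
elim: n => [|n ih] x /=; first exact: cvg_id.
by apply: continuous_comp; [exact: ih|exact: cf].
Qed.

Lemma comp0n_hat_seq n (mu : bprob R X) B : borel B ->
  comp0n (hat_seq cf) n mu B = mu (comp0n f n @^-1` B).
Proof.
elim: n B => [//|n ih] B bB /=; case: pselect => [?|//].
by rewrite ih//; exact: continuous_borel_preimage.
Qed.

End iterates.

Lemma seq_entropy_of_hat (R : realType) (X : metricType R) (f : nat -> X -> X)
    (cf : forall n, continuous (f n)) (a : nat -> nat) :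
  @seq_entropy R (bprob R X) prohorov_open (hat_seq cf) a = 0%E ->
  @seq_entropy R X open f a = 0%E.
Proof.
move=> /(seq_entropy_eq0P _ _ prohorov_openT) h; apply/seq_entropy_eq0P; first exact: openT.
move=> C opC b b0; have [/finite_seqP[s Cs] Cop CT] := opC.
(* If all members of the cover had mass at most [c], the whole space would have mass at most
   [size s / (size s + 1) < 1]; hence the sets [hat U] cover. *)
pose c : R := (size s).+1%:R^-1.
have c0 : 0 < c by rewrite invr_gt0.
pose hat (U : set X) := [set mu : bprob R X | c < mu U].
have opH : finite_open_cover prohorov_open [set hat U | U in C].
  split.
  - by apply: finite_image; apply/finite_seqP; exists s.
  - by move=> _ [U /Cop oU <-]; exact: prohorov_open_mass.
  - rewrite -subTset => mu _; apply: contrapT => nmu.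
    have cle U : U \in s -> mu U <= c.
      move=> Us; rewrite leNgt; apply/negP => cU; apply: nmu.
      by exists (hat U) => //; exists U => //; rewrite Cs.
    have bs (i : 'I_(size s)) : borel (nth set0 s i).
      by apply: borel_open; apply: Cop; rewrite Cs /= mem_nth.
    have : 1 <= \sum_(i < size s) mu (nth set0 s i).
      rewrite -(bp_setT mu) (le_trans _ (bprob_bigsetU_le mu _ bs))//.
      apply: le_bprob; [exact: borelT|exact: borel_bigsetU|].
      rewrite -CT => x [U]; rewrite Cs /= => Us Ux.
      rewrite -bigcup_seq; exists (Ordinal (etrans (index_mem U s) Us)) => /=.
        by rewrite mem_index_enum.
      by rewrite nth_index.
    apply/negP; rewrite -ltNge.
    apply: (@le_lt_trans _ _ (\sum_(i < size s) c)).
      by apply: ler_sum => i _; rewrite cle// mem_nth.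
    rewrite sumr_const card_ord -mulr_natl /c ltr_pdivrMr ?ltr0n// mul1r.
    by rewrite ltr_nat.
have [N NP] := h _ opH b b0; exists N => n /NP; apply: le_trans.
apply: (@le_Ncov _ _ _ (@dirac_bprob R X)); last exact: subcover_join_pre opH.
move=> V [t [tH ->]].
have /choice[u uP] : forall i, exists U, (i < n)%N -> C U /\ t i = hat U.
  move=> i; have [/tH[U CU <-]|] := boolP (i < n)%N; first by exists U.
  by exists set0.
exists (\bigcap_(i in [set i | (i < n)%N]) (comp0n f (a i) @^-1` u i)).
  by exists u; split => // i /uP[].
move=> x xt i /= ni; have [Cu tu] := uP _ ni.
have := xt i ni; rewrite tu /hat /= comp0n_hat_seq; last exact: borel_open (Cop _ Cu).
by move=> /(lt_trans c0)/dirac_bprob_gt0.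
Qed.

(** * Compactness of the space of probability measures *)

Section compact_metric.
Context {R : realType} {X : metricType R}.
Implicit Types (K U V W : set X).

Lemma not_eps_nbhdC U (e : R) x :
  ~ eps_nbhd (~` U) e x <-> forall y, mdist x y < e -> U y.
Proof.
split=> [nx y xy|xU [y nUy /xU]//].
by apply: contrapT => nUy; apply: nx; exists y.
Qed.

Lemma near_mdist (x : X) (e : R) : 0 < e -> \forall y \near x, mdist x y < e.
Proof. by move=> e0; apply/nbhs_ballP; exists e => // y; rewrite ballEmdist. Qed.

Lemma open_mdist U x : open U -> U x ->
  exists2 e : R, 0 < e & forall y, mdist x y < e -> U y.
Proof.
rewrite openE => /[apply] /nbhs_ballP[e e0 xU]; exists e => // y xy.
by apply: xU; rewrite ballEmdist.
Qed.

(** A Lebesgue number for a cover by two sets: each point of [K] has its [r]-ball inside [U] or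
    inside [V]. The two sets on the right are closed, which lets a closed set be split along [U] and
    [V]. *)
Lemma compact_lebesgue2 K U V : compact K -> open U -> open V -> K `<=` U `|` V ->
  exists2 r : R, 0 < r & K `<=` ~` eps_nbhd (~` U) r `|` ~` eps_nbhd (~` V) r.
Proof.
move=> /compact_near_coveringP cK oU oV KUV.
pose P (r : R) x := ~ eps_nbhd (~` U) r x \/ ~ eps_nbhd (~` V) r x.
have near_in W x : open W -> W x ->
    \forall x' \near x & r \near (0:R)^'+, ~ eps_nbhd (~` W) r x'.
  move=> oW Wx; have [e e0 xW] := open_mdist oW Wx.
  have e20 : 0 < e / 2 by rewrite divr_gt0.
  exists ([set x' | mdist x x' < e / 2], [set r | r < e / 2]) => /=.
    by split; [exact: near_mdist|exact: nbhs_right_lt].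
  move=> [x' r] /= [xx' re]; apply/not_eps_nbhdC => y x'y; apply: xW.
  rewrite (le_lt_trans (metric_triangle _ x' _))// [ltRHS]splitr ltrD//.
  exact: lt_trans re.
have KP x : K x -> \forall x' \near x & r \near (0:R)^'+, P r x'.
  by move=> /KUV[/(near_in _ _ oU)|/(near_in _ _ oV)];
    apply: filterS => -[x' r] /= ?; [left|right].
have [e /= e0 eP] := cK R (0:R)^'+ P _ KP.
exists (e / 2); first by rewrite divr_gt0.
apply: eP; last by rewrite divr_gt0.
by rewrite /= sub0r normrN gtr0_norm ?divr_gt0// ltr_pdivrMr// ltr_pMr// ltr1n.
Qed.

Lemma compact_bigcup_nat K (W : (set X)^nat) : compact K ->
  (forall i, open (W i)) -> K `<=` \bigcup_i W i ->
  exists n, K `<=` \big[setU/set0]_(i < n) W i.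
Proof.
move=> /compact_near_coveringP cK oW KW.
have [|N _ NP] := cK nat \oo (fun n x => (\big[setU/set0]_(i < n) W i) x) _.
  move=> x /KW[i _ Wx]; near=> x' n; rewrite -bigcup_mkord; exists i => /=.
    by near: n; exact: nbhs_infty_gt.
  by near: x'; apply: (open_nbhs_nbhs (conj (oW i) Wx)).
by exists N; apply: NP => /=.
Unshelve. all: by end_near. Qed.

(* The filter of the finite lists containing a given one turns compactness in
   the near-covering form into the existence of finite subcovers. *)
Lemma compact_small_cover (e : R) : compact [set: X] -> 0 < e ->
  exists c : seq (set X), [/\ forall U, U \in c -> open U,
    forall U x y, U \in c -> U x -> U y -> mdist x y < e &
    forall x, exists2 U, U \in c & U x].
Proof.
move=> /compact_near_coveringP cX e0.
pose F : set_system (seq X) := [set S : set (seq X) |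
  exists s0 : seq X, forall s : seq X, {subset s0 <= s} -> S s].
have FF : Filter F.
  split; first by exists [::].
    move=> A B [s0 As] [t0 Bs]; exists (s0 ++ t0) => s ss; split.
      by apply: As => x xs; apply: ss; rewrite mem_cat xs.
    by apply: Bs => x xs; apply: ss; rewrite mem_cat xs orbT.
  by move=> A B AB [s0 As]; exists s0 => s /As /AB.
have e20 : 0 < e / 2 by rewrite divr_gt0.
have [|s0 s0P] := cX _ F (fun s x => exists2 y, y \in s & mdist x y < e / 2) FF.
  move=> x _; exists ([set x' | mdist x x' < e / 2], [set s : seq X | x \in s]) => /=.
    by split; [exact: near_mdist|exists [:: x] => s; apply; rewrite inE].
  by move=> [x' s] /= [xx' xs]; exists x => //; rewrite metric_sym.
exists [seq eps_nbhd [set x] (e / 2) | x <- s0]; split.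
- by move=> _ /mapP[x _ ->]; exact: open_eps_nbhd.
- move=> _ x y /mapP[z _ ->] [_ -> xz] [_ -> yz].
  rewrite (le_lt_trans (metric_triangle _ z _))// [ltRHS]splitr ltrD//.
  by rewrite metric_sym.
- move=> x; have [//|y ys xy] := s0P s0 _ x I.
  by exists (eps_nbhd [set y] (e / 2)); [exact: map_f|exists y].
Qed.

End compact_metric.

(* From a finitely additive [m], the inner measure of open sets by closed sets
   extends to an outer measure for which open sets are measurable. *)
Section regularization.
Context {R : realType} {X : metricType R}.
Hypothesis cX : compact [set: X].
Variable m : set X -> R.
Hypothesis mT : m [set: X] = 1.
Hypothesis mU : forall A B, borel A -> borel B -> A `&` B = set0 ->
  m (A `|` B) = m A + m B.
Hypothesis mU_le : forall A B, borel A -> borel B -> m (A `|` B) <= m A + m B.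
Hypothesis m_le : forall A B, borel A -> borel B -> A `<=` B -> m A <= m B.
Implicit Types (A K U V W : set X).

Let m0 : m set0 = 0.
Proof.
have := mU borel0 borel0 (setI0 _); rewrite setU0 => /eqP.
by rewrite -subr_eq0 opprD addrA subrr sub0r oppr_eq0 => /eqP.
Qed.

Let inn W := sup [set m K | K in [set K | closed K /\ K `<=` W]].

Let has_sup_inn W : has_sup [set m K | K in [set K | closed K /\ K `<=` W]].
Proof.
split; first by exists (m set0), set0 => //; split => //; exact: closed0.
exists 1 => _ [K [cK _] <-]; rewrite -mT.
by apply: m_le => //; [exact: borel_closed|exact: borelT].
Qed.

Let inn_ub W K : closed K -> K `<=` W -> m K <= inn W.
Proof. by move=> cK KW; apply: (sup_upper_bound (has_sup_inn W)); exists K. Qed.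

Let inn_le W c : (forall K, closed K -> K `<=` W -> m K <= c) -> inn W <= c.
Proof.
move=> h; apply: ge_sup; first exact: (has_sup_inn W).1.
by move=> _ [K [cK KW] <-]; exact: h.
Qed.

Let inn_adherent W e : 0 < e -> exists K, [/\ closed K, K `<=` W & inn W - e < m K].
Proof.
by move=> /sup_adherent/(_ (has_sup_inn W))[_ [K [cK KW] <-] ?]; exists K.
Qed.

Let inn_ge0 W : 0 <= inn W.
Proof. by rewrite -m0; apply: inn_ub => //; exact: closed0. Qed.

Let inn_le1 W : inn W <= 1.
Proof.
apply: inn_le => K cK _; rewrite -mT.
by apply: m_le => //; [exact: borel_closed|exact: borelT].
Qed.

(** A closed subset of the union splits, by a Lebesgue number, into a closed subset of [V] and one
    of [W]. *)
Let innU_le V W : open V -> open W -> inn (V `|` W) <= inn V + inn W.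
Proof.
move=> oV oW; apply: inn_le => K cK KVW.
have [r r0 Kr] := compact_lebesgue2 (subclosed_compact cK cX (@subsetT _ K)) oV oW KVW.
have cE U : closed (~` eps_nbhd (~` U) r).
  by apply: open_closedC; exact: open_eps_nbhd.
have sE U : ~` eps_nbhd (~` U) r `<=` U.
  by move=> x; apply: contra_notP => nUx; exact: sub_eps_nbhd.
rewrite (_ : K = (K `&` ~` eps_nbhd (~` V) r) `|` (K `&` ~` eps_nbhd (~` W) r)).
  apply: (le_trans (mU_le _ _)); try by apply: borel_closed; exact: closedI.
  by apply: lerD; apply: inn_ub; try exact: closedI; move=> x [_ /sE].
by rewrite -setIUr; apply/esym/setIidPl.
Qed.

Let inn_bigsetU_le (W : (set X)^nat) n : (forall i, open (W i)) ->
  inn (\big[setU/set0]_(i < n) W i) <= \sum_(i < n) inn (W i).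
Proof.
move=> oW; elim: n => [|n ih].
  by rewrite !big_ord0; apply: inn_le => K _; rewrite subset0 => ->; rewrite m0.
rewrite !big_ord_recr/= (le_trans (innU_le _ _)) ?lerD2r//.
by rewrite -bigcup_mkord; exact: bigcup_open.
Qed.

Let out A := inf [set inn W | W in [set W | open W /\ A `<=` W]].

Let has_inf_out A : has_inf [set inn W | W in [set W | open W /\ A `<=` W]].
Proof.
split; first by exists (inn setT), setT => //; split => //; exact: openT.
by exists 0 => _ [W _ <-].
Qed.

Let out_lb A W : open W -> A `<=` W -> out A <= inn W.
Proof. by move=> oW AW; apply: (ge_inf (has_inf_out A).2); exists W. Qed.

Let out_ge A c : (forall W, open W -> A `<=` W -> c <= inn W) -> c <= out A.
Proof.
move=> h; apply: lb_le_inf; first exact: (has_inf_out A).1.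
by move=> _ [W [oW AW] <-]; exact: h.
Qed.

Let out_adherent A e : 0 < e -> exists W, [/\ open W, A `<=` W & inn W < out A + e].
Proof.
by move=> /inf_adherent/(_ (has_inf_out A))[_ [W [oW AW] <-] ?]; exists W.
Qed.

Let out_ge0 A : 0 <= out A.
Proof. exact: out_ge. Qed.

Let eout A : \bar R := (out A)%:E.

Let eout0 : eout set0 = 0%E.
Proof.
congr EFin; apply/eqP; rewrite eq_le out_ge0 andbT.
apply: (le_trans (out_lb open0 _)) => //.
by apply: inn_le => K _; rewrite subset0 => ->; rewrite m0.
Qed.

Let eout_ge0 A : (0 <= eout A)%E.
Proof. by rewrite lee_fin. Qed.

Let le_eout : {homo eout : A B / A `<=` B >-> (A <= B)%E}.
Proof.
move=> A B AB; rewrite lee_fin; apply: out_ge => W oW BW.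
by apply: out_lb => // x /AB/BW.
Qed.

(** Each [F i] is enclosed in an open set up to [e / 2^(i+1)]. A closed subset of the union of these
    open sets is compact, so finitely many contain it and finite subadditivity of [inn] suffices. *)
Let eout_sigma_subadditive : sigma_subadditive eout.
Proof.
move=> F; apply/lee_addgt0Pr => e e0.
have /choice[W WP] i : exists W, [/\ open W, F i `<=` W &
    inn W < out (F i) + e / (2 ^ i.+1)%:R].
  by apply: out_adherent; rewrite divr_gt0// ltr0n expn_gt0.
apply: le_trans (epsilon_trick xpredT _ (ltW e0)); last by move=> n; exact: eout_ge0.
apply: (@le_trans _ _ (\sum_(0 <= i <oo) (inn (W i))%:E)%E); last first.
  apply: lee_nneseries => [i _ _|i _]; first by rewrite lee_fin.
  by rewrite /eout -EFinD lee_fin ltW//; case: (WP i).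
have oW i : open (W i) by case: (WP i).
apply: (@le_trans _ _ (inn (\bigcup_i W i))%:E).
  rewrite lee_fin; apply: out_lb; first exact: bigcup_open.
  by apply: subset_bigcup => i _; case: (WP i).
have -> : (inn (\bigcup_i W i))%:E =
    ereal_sup [set (m K)%:E | K in [set K | closed K /\ K `<=` \bigcup_i W i]].
  rewrite -ereal_sup_EFin; [|exact: (has_sup_inn _).2|exact: (has_sup_inn _).1].
  by rewrite image_comp.
apply: ge_ereal_sup => _ [K [cK KW] <-].
have [n Kn] := compact_bigcup_nat (subclosed_compact cK cX (@subsetT _ K)) oW KW.
apply: le_trans (@nneseries_lim_ge _ _ xpredT 0 n _); last first.
  by move=> i _ _; rewrite lee_fin.
rewrite sumEFin lee_fin big_mkord (le_trans _ (inn_bigsetU_le n oW))//.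
exact: inn_ub.
Qed.

HB.instance Definition _ := isOuterMeasure.Build R X eout
  eout0 eout_ge0 le_eout eout_sigma_subadditive.

Let eout_caratheodory_open U : open U -> eout.-caratheodory U.
Proof.
move=> oU; apply: le_caratheodory_measurable => A.
rewrite -EFinD lee_fin; apply: out_ge => W oW AW.
apply/ler_addgt0Pr => e e0; have e20 : 0 < e / 2 by rewrite divr_gt0.
(* [K] nearly fills [W] inside [U], and [L] nearly fills the rest of [W] off [K]. They are closed
   and disjoint, so [m K + m L] is at most [inn W]; the set [A] outside [U] lies in [W] off [K]. *)
have [K [cK KWU Ke]] := inn_adherent (W `&` U) e20.
have [L [cL LWK Le]] := inn_adherent (W `&` ~` K) e20.
have : out (A `&` U) <= inn (W `&` U).
  by apply: out_lb; [exact: openI|exact: setSI].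
have : out (A `&` ~` U) <= inn (W `&` ~` K).
  apply: out_lb; first by apply: openI => //; exact: closed_openC.
  by move=> x [/AW ? nUx]; split => // /KWU[].
have : m (K `|` L) <= inn W.
  by apply: inn_ub; [exact: closedU|move=> x [/KWU[]|/LWK[]]].
rewrite mU; [lra|exact: borel_closed|exact: borel_closed|].
by rewrite -subset0 => x [Kx /LWK[]].
Qed.

Let eout_caratheodory_borel B : borel B -> eout.-caratheodory B.
Proof.
apply: smallest_sub => //; split.
- exact: caratheodory_measurable_set0.
- by move=> A cA; rewrite setTD; exact: caratheodory_measurable_setC.
- by move=> F cF; exact: caratheodory_measurable_bigcup.
Qed.

Let mu B := if pselect (borel B) then out B else 0.

Let muE B : borel B -> mu B = out B.
Proof. by move=> bB; rewrite /mu; case: pselect. Qed.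

Let mu_nonborel B : ~ borel B -> mu B = 0.
Proof. by move=> nB; rewrite /mu; case: pselect. Qed.

Let mu_ge0 B : 0 <= mu B.
Proof. by rewrite /mu; case: pselect => // ?; exact: out_ge0. Qed.

Let mu_setT : mu setT = 1.
Proof.
rewrite muE; last exact: borelT.
apply/eqP; rewrite eq_le (le_trans (out_lb openT _))//=.
apply: out_ge => W _ TW; rewrite -mT; apply: inn_ub => //; exact: closedT.
Qed.

Let mu_sigma_additive (F : nat -> set X) :
  (forall i, borel (F i)) -> trivIset [set: nat] F ->
  (fun n => \sum_(0 <= i < n) mu (F i)) @ \oo --> mu (\bigcup_i F i).
Proof.
move=> bF tF; rewrite muE; last exact: borel_bigcup.
have -> : (fun n => \sum_(0 <= i < n) mu (F i)) =
    fine \o (fun n => \sum_(0 <= i < n) eout (F i))%E.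
  apply/funext => n /=; rewrite sumEFin/=.
  by apply: eq_bigr => i _; rewrite muE.
apply: fine_cvg.
have <- : (\sum_(0 <= i <oo) eout (F i))%E = (out (\bigcup_i F i))%:E.
  apply/eqP; rewrite eq_le eout_sigma_subadditive andbT.
  have FE i : \bigcup_i F i `&` F i = F i.
    by rewrite setIC; apply/setIidPl => x Fx; exists i.
  (* Testing the Caratheodory inequality on the union itself gives the superadditive half. *)
  have := caratheodory_lime_le (fun i => eout_caratheodory_borel (bF i)) tF
    (\bigcup_i F i).
  rewrite setICr /= eout0 adde0.
  under eq_eseriesr => i _ do rewrite FE.
  exact.
by apply: is_cvg_nneseries.
Qed.

(** An open set around [K] has [K] among its closed subsets. By complements, [mu] is then at most
    [m] on open sets, the form in which the limit argument uses it. *)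
Lemma regularization :
  exists mu : bprob R X, forall K, closed K -> m K <= mu K.
Proof.
exists (BProb mu_nonborel mu_ge0 mu_setT mu_sigma_additive) => K cK /=.
rewrite muE; last exact: borel_closed.
by apply: out_ge => W _ KW; exact: inn_ub.
Qed.

End regularization.

(** Compactness of the unit interval gives a cluster point, and an ultrafilter converges to each of
    its cluster points. *)
Lemma ultra_cvg_unit (R : realType) (T : Type) (F : set_system T) (u : T -> R) :
  UltraFilter F -> (forall t, 0 <= u t <= 1) -> exists l : R, u @ F --> l.
Proof.
move=> uF u01.
have pF : ProperFilter (u @ F) by exact: fmap_proper_filter.
have [|l [_ clu]] := @segment_compact R 0 1 (u @ F) pF.
  by apply: nearW => t /=; rewrite in_itv/=; exact: u01.
exists l => N lN; have [//|nN] := in_ultra_setVsetC (u @^-1` N) uF.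
by have [x [nNx Nx]] := clu (~` N) N nN lN.
Qed.

(** * Ultralimits of measures and Lebesgue numbers of covers *)

Section lebesgue_number.
Context {R : realType} {X : metricType R}.
Hypothesis cX : compact [set: X].
Implicit Types mu nu : bprob R X.

Lemma eps_nbhdD (B : set X) (e e' : R) :
  eps_nbhd (eps_nbhd B e) e' `<=` eps_nbhd B (e + e').
Proof.
move=> x [y [z Bz yz] xy]; exists z => //.
by rewrite (le_lt_trans (metric_triangle _ y _))// addrC ltrD.
Qed.

Lemma prohorov_triangle mu nu rho (e e' : R) :
  prohorov mu nu < e -> prohorov nu rho < e' -> prohorov mu rho < e + e'.
Proof.
move=> /prohorov_ltP[d [d0 de dP]] /prohorov_ltP[d' [d'0 d'e d'P]].
apply/prohorov_ltP; exists (d + d'); split; rewrite ?addr_gt0 ?ltrD// => B bB.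
have := dP B bB; have := d'P _ (borel_eps_nbhd B d).
have : rho (eps_nbhd (eps_nbhd B d) d') <= rho (eps_nbhd B (d + d')).
  by apply: le_bprob; [exact: borel_eps_nbhd|exact: borel_eps_nbhd|exact: eps_nbhdD].
lra.
Qed.

Lemma bprob_ultralimit (F : set_system nat) (mu_ : nat -> bprob R X) :
  UltraFilter F ->
  exists mu, forall e, 0 < e -> \forall t \near F, prohorov mu (mu_ t) < e.
Proof.
move=> uF; have pF : ProperFilter F by exact: ultra_proper.
have /choice[m mP] (B : set X) : exists l : R, mu_ t B @[t --> F] --> l.
  by apply: ultra_cvg_unit => // t; rewrite bp_ge0 bprob_le1.
have cvgE (u : nat -> R) (l l' : R) : u @ F --> l -> u @ F --> l' -> l = l'.
  by move=> /cvg_lim ul /cvg_lim ul'; rewrite -ul// -ul'.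
have m_le A B : borel A -> borel B -> A `<=` B -> m A <= m B.
  move=> bA bB AB; apply: (ler_cvg_to (mP A) (mP B)).
  by apply: filterE => t; exact: le_bprob.
have mT : m setT = 1.
  apply: (cvgE _ _ _ (mP setT)); under eq_fun do rewrite bp_setT.
  exact: cvg_cst.
have mU A B : borel A -> borel B -> A `&` B = set0 -> m (A `|` B) = m A + m B.
  move=> bA bB AB; apply: (cvgE _ _ _ (mP _)).
  under eq_fun do rewrite bprobU//.
  by apply: cvgD; exact: mP.
have mU_le A B : borel A -> borel B -> m (A `|` B) <= m A + m B.
  move=> bA bB; apply: (ler_cvg_to (mP _) (cvgD (mP A) (mP B))).
  by apply: filterE => t; exact: bprobU_le.
have mC A : borel A -> m (~` A) = 1 - m A.
  move=> bA; rewrite -mT -(setUv A) mU ?setICr//; last exact: borelC.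
  by rewrite addrC addKr.
have [mu muP] := regularization cX mT mU mU_le m_le.
exists mu => e e0.
have mu_le W : open W -> mu W <= m W.
  move=> oW; have bW := borel_open oW.
  by have := muP _ (open_closedC oW); rewrite mC// bprobC//; lra.
have e20 : 0 < e / 2 by rewrite divr_gt0.
have e40 : 0 < e / 2 / 2 by rewrite divr_gt0.
have [c [oc dc cc]] := compact_small_cover cX e40.
(* Only finitely many unions [G S] exist, so the setwise convergence of masses is uniform over
   them. *)
pose G (S : {set 'I_(size c)}) := \big[setU/set0]_(i in S) nth set0 c i.
have bG S : borel (G S).
  rewrite /G; elim/big_ind : _ => [|A B bA bB|i _]; first exact: borel0.
    exact: borelU.
  by apply: borel_open; apply: oc; rewrite mem_nth.
have : \forall t \near F, forall S, m (G S) <= mu_ t (G S) + e / 2.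
  apply: filter_forall => S.
  have : \forall t \near F, m (G S) - e / 2 < mu_ t (G S).
    by apply: (cvgr_gt _ (mP (G S))); rewrite ltrBlDr ltrDl.
  by apply: filterS => t; lra.
apply: filterS => t tG; apply/prohorov_ltP; exists (e / 2); split => //.
  by rewrite ltr_pdivrMr// ltr_pMr// ltr1n.
move=> B bB.
(* [B] is first enlarged to an open set, where [mu] is at most [m], and then to a union [G S] of
   small cover members, which stays within [e / 2] of [B]. *)
pose W := eps_nbhd B (e / 2 / 2).
pose S : {set 'I_(size c)} := finset (fun i : 'I_(size c) => `[< nth set0 c i `&` W !=set0 >]).
have WG : W `<=` G S.
  move=> x Wx; have [U Uc Ux] := cc x.
  rewrite /G -bigcup_pred; exists (Ordinal (etrans (index_mem U c) Uc)) => /=.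
    by rewrite inE; apply/asboolP; exists x; rewrite nth_index.
  by rewrite nth_index.
have GB : G S `<=` eps_nbhd B (e / 2).
  rewrite /G -bigcup_pred => x [i /=]; rewrite inE => /asboolP[y [iy [z Bz yz]]] ix.
  exists z => //; rewrite (le_lt_trans (metric_triangle _ y _))//.
  by rewrite [ltRHS]splitr ltrD//; apply: dc ix iy; rewrite mem_nth.
have bW : borel W by exact: borel_eps_nbhd.
have : mu B <= mu W by apply: le_bprob => //; exact: sub_eps_nbhd.
have : mu W <= m W by apply: mu_le; exact: open_eps_nbhd.
have : m W <= m (G S) by exact: m_le.
have : mu_ t (G S) <= mu_ t (eps_nbhd B (e / 2)).
  by apply: le_bprob => //; exact: borel_eps_nbhd.
by have := tG S; lra.
Qed.

(** Otherwise there is, for each [n], a measure whose ball of radius [1/(n+1)] lies in no member.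
    The member that contains an ultralimit of these measures contains a ball around the limit, hence
    one of those small balls. *)
Lemma prohorov_lebesgue_number (C : set (set (bprob R X))) :
  C `<=` prohorov_open -> \bigcup_(U in C) U = setT ->
  exists2 e : R, 0 < e &
    forall mu, exists2 U, C U & [set nu | prohorov mu nu < e] `<=` U.
Proof.
move=> oC CT; apply: contrapT => nC.
have /choice[mu_ mu_P] (n : nat) : exists mu, forall U, C U ->
    ~ [set nu | prohorov mu nu < n.+1%:R^-1] `<=` U.
  apply: contrapT => nmu; apply: nC; exists n.+1%:R^-1; first by rewrite invr_gt0.
  move=> mu; apply: contrapT => nU; apply: nmu; exists mu => U CU muU.
  by apply: nU; exists U.
have [F [uF ooF]] := ultraFilterLemma eventually_filter.
have [mu muF] := bprob_ultralimit mu_ uF.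
have : setT mu by []; rewrite -CT => -[U CU Umu].
have [e e0 eU] := oC U CU mu Umu.
have e20 : 0 < e / 2 by rewrite divr_gt0.
have near_e : \forall n \near F, n.+1%:R^-1 < e / 2.
  exact: ooF (near_infty_natSinv_lt (PosNum e20)).
have [n [ne mun]] := filter_ex (filterI near_e (muF _ e20)).
apply: (mu_P n U CU) => nu /= nun; apply: eU => /=; rewrite [ltRHS]splitr.
exact: prohorov_triangle mun (lt_trans nun ne).
Qed.

End lebesgue_number.

(** * Counting convex combinations up to a small error *)

Section convex_combinations.
Context {R : realType}.

Definition simplex m (w : 'I_m -> R) := (forall j, 0 <= w j) /\ \sum_j w j = 1.

Lemma simplex_exists_le m (w x : 'I_m -> R) (c : R) : simplex w ->
  \sum_j w j * x j <= c -> exists j, x j <= c.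
Proof.
move=> [w0 w1] wx; apply: contrapT => nx.
have cx j : c < x j by rewrite ltNge; apply/negP => xj; apply: nx; exists j.
have wcx j : 0 <= w j * (x j - c) by rewrite mulr_ge0// subr_ge0 ltW.
have : \sum_j w j * (x j - c) == 0.
  rewrite eq_le sumr_ge0// andbT.
  under eq_bigr do rewrite mulrBr.
  by rewrite sumrB -mulr_suml w1 mul1r subr_le0.
rewrite psumr_eq0// => /allP wj0; move: w1; rewrite big1 => [/eqP|j _].
  by rewrite eq_sym oner_eq0.
have /implyP/(_ isT) := wj0 j (mem_index_enum _).
by rewrite mulf_eq0 subr_eq0 (gt_eqF (cx j)) orbF => /eqP.
Qed.

(* Maurey's sampling argument, derandomised: appending to the sample a vector
   that does at least as well as the [w]-average increases the squared norm of
   the sum by at most [M]. *)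
Lemma exists_balanced_sample m (I : finType) (w : 'I_m -> R)
    (v : 'I_m -> I -> R) (M : R) k :
  simplex w -> (forall t, \sum_j w j * v j t = 0) ->
  (forall j, \sum_t v j t ^+ 2 <= M) ->
  exists J : k.-tuple 'I_m, \sum_t (\sum_(j <- J) v j t) ^+ 2 <= k%:R * M.
Proof.
move=> sw wv vM; elim: k => [|k [J JP]].
  exists [tuple]; rewrite mul0r big1// => t _.
  by rewrite big_nil expr0n.
pose S t := \sum_(j <- J) v j t.
have [|j jP] := @simplex_exists_le _ w
    (fun j => \sum_t (v j t + S t) ^+ 2) (k.+1%:R * M) sw; last first.
  by exists (cons_tuple j J); under eq_bigr do rewrite big_cons.
(* The cross terms average out because the [w]-mean of [v] is 0. *)
have -> : \sum_j w j * \sum_t (v j t + S t) ^+ 2 =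
    \sum_j w j * (\sum_t v j t ^+ 2) + \sum_t S t ^+ 2.
  transitivity (\sum_j (w j * (\sum_t v j t ^+ 2) + (w j * (\sum_t S t ^+ 2)
      + \sum_t w j * v j t * (S t *+ 2)))).
    apply: eq_bigr => j _; rewrite !mulr_sumr -!big_split/=.
    by apply: eq_bigr => t _; rewrite sqrrD; ring.
  rewrite !big_split/= -mulr_suml sw.2 mul1r exchange_big/=.
  rewrite [X in _ + (_ + X)]big1 ?addr0// => t _.
  by rewrite -mulr_suml wv mul0r.
rewrite -natr1 mulrDl mul1r addrC lerD//.
rewrite -[leRHS]mul1r -sw.2 mulr_suml; apply: ler_sum => j _.
by rewrite ler_wpM2l// sw.1.
Qed.

Definition nonzeros (I : finType) g (h : {ffun I -> 'I_g.+1}) : nat :=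
  \sum_t (h t != ord0).

(* Weighting [h] by [expR (- z)] to the number of its nonzero values turns the
   count into a product. *)
Lemma card_sparse_le (I : finType) g (D z : R) (A : {set {ffun I -> 'I_g.+1}}) :
  0 <= z -> (forall h, h \in A -> (nonzeros h)%:R <= D) ->
  #|A|%:R <= expR (z * D + #|I|%:R * (g%:R * expR (- z))).
Proof.
move=> z0 AD.
pose F (b : bool) : R := if b then expR (- z) else 1.
have F0 b : 0 <= F b by case: b; rewrite /F ?expR_ge0.
have FE (h : {ffun I -> 'I_g.+1}) :
    \prod_t F (h t != ord0) = expR (- z * (nonzeros h)%:R).
  rewrite /nonzeros natr_sum mulr_sumr expR_sum; apply: eq_bigr => t _.
  by case: (h t != ord0); rewrite /F ?mulr1// mulr0 expR0.
(* Per coordinate, the zero value weighs 1 and each of the [g] others weighs [expR (- z)]. *)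
have key : \sum_(h : {ffun I -> 'I_g.+1}) \prod_t F (h t != ord0) =
    (1 + g%:R * expR (- z)) ^+ #|I|.
  rewrite -(bigA_distr_bigA (fun _ (x : 'I_g.+1) => F (x != ord0))).
  rewrite prodr_const big_ord_recl eqxx/=; congr ((1 + _) ^+ _).
  by rewrite sumr_const card_ord mulr_natl.
have le1 : #|A|%:R * expR (- (z * D)) <= (1 + g%:R * expR (- z)) ^+ #|I|.
  rewrite -key mulr_natl -sumr_const.
  apply: (@le_trans _ _ (\sum_(h in A) \prod_t F (h t != ord0))).
    apply: ler_sum => h /AD hD; rewrite FE ler_expR mulNr lerN2.
    by rewrite ler_wpM2l.
  rewrite [leRHS](bigID (mem A))/= lerDl sumr_ge0// => h _.
  exact: prodr_ge0.
have : (1 + g%:R * expR (- z)) ^+ #|I| <= expR (#|I|%:R * (g%:R * expR (- z))).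
  rewrite expRM_natl lerXn2r ?expR_ge1Dx// nnegrE ?expR_ge0//.
move=> /(le_trans le1); rewrite -ler_pdivlMr ?expR_gt0// -expRN opprK.
by rewrite mulrC -expRD.
Qed.

Lemma sum_mem01 m (w e : 'I_m -> R) : simplex w -> (forall j, 0 <= e j <= 1) ->
  0 <= \sum_j w j * e j <= 1.
Proof.
move=> [w0 w1] e01; apply/andP; split.
  by apply: sumr_ge0 => j _; rewrite mulr_ge0//; case/andP: (e01 j).
by rewrite -w1 ler_sum// => j _; rewrite ler_piMr//; case/andP: (e01 j).
Qed.

(* The deviation [x] of a coordinate from its sample mean is rounded at scale
   [L^-1], the value [ord0] being reserved for the deviations below [L^-1]. *)
Definition round_dev (L : nat) (x : R) : 'I_(L.*2.+2) :=
  if L%:R * `|x| < 1 then ord0 else inord (Num.truncn (L%:R * x + L.+1%:R)).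

(** The shift by [L + 1] moves [L * x] into the interval from 1 to [2L + 1]: the integer part fits
    the type and never meets the reserved value 0. *)
Lemma round_devE L x : `|x| <= 1 -> 1 <= L%:R * `|x| ->
  (0 < Num.truncn (L%:R * x + L.+1%:R))%N /\
  (round_dev L x : nat) = Num.truncn (L%:R * x + L.+1%:R).
Proof.
rewrite ler_norml => /andP[x1 x2] Lx.
have L0 : 0 <= L%:R :> R by [].
have : - L%:R <= L%:R * x by rewrite -mulrN1 ler_wpM2l.
have : L%:R * x <= L%:R by rewrite ler_piMr.
rewrite /round_dev ltNge Lx /= -natr1 => h1 h2; split.
  by rewrite truncn_gt0; lra.
rewrite inordK// ltnS truncn_le_nat -addnn -!natr1 natrD; lra.
Qed.

(** Equal codes mean that both deviations are below [1/L], or that [L * x] and [L * x'] share a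
    shifted integer part; the mixed cases clash with the reserved value. *)
Lemma round_dev_close L x x' : (0 < L)%N -> `|x| <= 1 -> `|x'| <= 1 ->
  round_dev L x = round_dev L x' -> `|x - x'| <= 2 / L%:R.
Proof.
move=> L0 x1 x'1 xx'; rewrite ler_pdivlMr ?ltr0n// mulrC.
have [Lx|Lx] := ltP (L%:R * `|x|) 1; have [Lx'|Lx'] := ltP (L%:R * `|x'|) 1.
- have := ler_normB x x'; rewrite -(ler_pM2l (_ : 0 < L%:R)) ?ltr0n// mulrDr; lra.
- have [+ xE] := round_devE x'1 Lx'.
  by rewrite -xE -xx' /round_dev Lx.
- have [+ xE] := round_devE x1 Lx.
  by rewrite -xE xx' /round_dev Lx'.
have [t0 xE] := round_devE x1 Lx; have [t'0 x'E] := round_devE x'1 Lx'.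
have tt' : Num.truncn (L%:R * x + L.+1%:R) = Num.truncn (L%:R * x' + L.+1%:R).
  by rewrite -xE -x'E xx'.
have : 0 <= L%:R * x + L.+1%:R by move: t0; rewrite truncn_gt0; lra.
move=> /truncn_itv/andP[].
have : 0 <= L%:R * x' + L.+1%:R by move: t'0; rewrite truncn_gt0; lra.
move=> /truncn_itv/andP[].
rewrite -tt' -natr1.
have -> : L%:R * `|x - x'| = `|L%:R * x - L%:R * x'|.
  by rewrite -mulrBr normrM ger0_norm.
by rewrite ler_norml; lra.
Qed.

(** Chebyshev's inequality: a coordinate with nonzero code contributes at least 1 to the right-hand
    side. *)
Lemma nonzeros_round_dev (I : finType) L (x : I -> R) :
  (nonzeros [ffun t => round_dev L (x t)])%:R <= L%:R ^+ 2 * \sum_t x t ^+ 2.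
Proof.
rewrite /nonzeros natr_sum mulr_sumr; apply: ler_sum => t _; rewrite ffunE.
have [_|] := eqVneq (round_dev L (x t)) ord0.
  by rewrite mulr_ge0// sqr_ge0.
rewrite /round_dev; case: ltP => [_|Lx _]; first by rewrite eqxx.
by rewrite -[x t ^+ 2]real_normK ?num_real// -exprMn exprn_ege1.
Qed.

(** The code of [s] is a balanced sample of [k] indices together with the rounded deviations from
    the sample mean. Sampling makes the squared deviations sum to at most [#|I| / k], so few rounded
    values are nonzero. *)
Lemma convex_coding (I : finType) m (e : 'I_m -> I -> R) (Z : Type)
    (w : Z -> 'I_m -> R) (k L : nat) (z : R) :
  (forall j t, 0 <= e j t <= 1) -> (forall s, simplex (w s)) ->
  (0 < k)%N -> (0 < L)%N -> 0 <= z ->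
  exists (T : finType) (A : {set T}) (code : Z -> T),
  [/\ forall s, code s \in A,
      forall s s', code s = code s' -> forall t,
        `|\sum_j w s j * e j t - \sum_j w s' j * e j t| <= 2 / L%:R &
      #|A|%:R <= m%:R ^+ k * expR (z * (L%:R ^+ 2 * #|I|%:R / k%:R)
                               + #|I|%:R * (L.*2.+1%:R * expR (- z)))].
Proof.
move=> e01 sw k0 L0 z0.
pose p s t := \sum_j w s j * e j t.
have p01 s t : 0 <= p s t <= 1 by apply: sum_mem01.
pose emp (J : k.-tuple 'I_m) t := k%:R^-1 * \sum_(j <- J) e j t.
have kn0 : k%:R != 0 :> R by rewrite pnatr_eq0 -lt0n.
have kE (J : k.-tuple 'I_m) c : k%:R * c = \sum_(j <- J) c :> R.
  by rewrite big_const_seq count_predT size_tuple iter_addr_0 mulr_natl.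
have emp01 J t : 0 <= emp J t <= 1.
  apply/andP; split.
    by rewrite mulr_ge0 ?invr_ge0// sumr_ge0// => j _; case/andP: (e01 j t).
  rewrite /emp mulrC ler_pdivrMr ?ltr0n// mul1r -[leRHS]mulr1 (kE J).
  by apply: ler_sum => j _; case/andP: (e01 j t).
pose dev J s t := p s t - emp J t.
have dev1 J s t : `|dev J s t| <= 1.
  by move: (p01 s t) (emp01 J t); rewrite ler_norml /dev; lra.
have /choice[J JP] s : exists J, \sum_t dev J s t ^+ 2 <= #|I|%:R / k%:R.
  have [||J JP] := @exists_balanced_sample _ I (w s)
      (fun j t => e j t - p s t) #|I|%:R k (sw s).
  - move=> t; under eq_bigr do rewrite mulrBr.
    by rewrite sumrB -mulr_suml (sw s).2 mul1r subrr.
  - move=> j; rewrite -sum1_card natr_sum; apply: ler_sum => t _.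
    rewrite -real_normK ?num_real// exprn_ile1//.
    by move: (p01 s t) (e01 j t); rewrite ler_norml; lra.
  exists J.
  have -> : \sum_t dev J s t ^+ 2 =
      k%:R ^- 2 * \sum_t (\sum_(j <- J) (e j t - p s t)) ^+ 2.
    rewrite mulr_sumr; apply: eq_bigr => t _.
    rewrite sumrB -kE /dev /emp -exprVn -exprMn mulrBr mulKf//.
    by rewrite -sqrrN opprB.
  rewrite ler_pdivrMl ?exprn_gt0 ?ltr0n// (le_trans JP)//.
  suff -> : k%:R ^+ 2 * (#|I|%:R / k%:R) = k%:R * #|I|%:R :> R by [].
  by rewrite expr2 -mulrA [X in _ * X = _]mulrC divfK.
pose T : finType := (k.-tuple 'I_m * {ffun I -> 'I_(L.*2.+2)})%type.
pose D : R := L%:R ^+ 2 * #|I|%:R / k%:R.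
pose B : {set {ffun I -> 'I_(L.*2.+2)}} :=
  finset (fun h => `[< (nonzeros h)%:R <= D >]).
exists T, (finset.setX finset.setT B),
  (fun s => (J s, [ffun t => round_dev L (dev (J s) s t)])); split.
- move=> s; rewrite finset.in_setX !inE /=.
  apply: (le_trans (nonzeros_round_dev _ _)); rewrite /D -mulrA.
  by rewrite ler_wpM2l.
- move=> s s' [JJ /ffunP hh] t; have := hh t; rewrite !ffunE.
  move=> /(round_dev_close L0 (dev1 _ _ _) (dev1 _ _ _)).
  by rewrite /dev JJ opprB addrA subrK.
rewrite finset.cardsX finset.cardsT card_tuple card_ord natrM natrX ler_wpM2l//.
by apply: card_sparse_le => // h; rewrite inE => /asboolP.
Qed.

End convex_combinations.

(** * Zero entropy of the induced system *)

Section partitions.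
Context {R : realType} {X : metricType R}.

(* The pieces [P j] are a near-minimal subcover of the [n]-th join made disjoint;
   [kappa j i] is the member of [c] that [P j] visits at time [a i]. *)
Lemma join_partition (f : nat -> X -> X) (cf : forall n, continuous (f n))
    (a : nat -> nat) (c : seq (set X)) n :
  (forall U, U \in c -> open U) -> (forall x, exists2 U, U \in c & U x) ->
  exists (m : nat) (P : 'I_m -> set X) (kappa : 'I_m -> 'I_n -> 'I_(size c)),
  [/\ m%:R < Ncov (join_pre f a n [set` c]) + 1 :> R,
      forall j, borel (P j), trivIset setT P, \bigcup_j P j = setT &
      forall j i x, P j x -> nth set0 c (kappa j i) (comp0n f (a i) x)].
Proof.
move=> oc cT.
have opC : finite_open_cover open [set` c].
  split; [exact: finite_seq|exact: oc|].
  by rewrite -subTset => x _; have [U Uc Ux] := cT x; exists U.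
have [s [sJ sT] sN] := exists_subcover_size_lt (R := R) (subcover_join_pre f a n opC).
pose V := nth set0 s.
have VJ (j : 'I_(size s)) : join_pre f a n [set` c] (V j) by apply: sJ; rewrite mem_nth.
have bV j : borel (V j).
  have [js|js] := ltnP j (size s); last by rewrite /V nth_default//; exact: borel0.
  have [t [tc ->]] := VJ (Ordinal js).
  apply: borel_open; rewrite bigcap_mkord; elim/big_ind : _ => [|A B oA oB|i _].
  - exact: openT.
  - exact: openI.
  - by apply: open_comp => [x _|]; [exact: continuous_comp0n|apply: oc; exact: tc].
have /choice[kappa kP] : forall j : 'I_(size s), exists k : 'I_n -> 'I_(size c),
    forall i x, V j x -> nth set0 c (k i) (comp0n f (a i) x).
  move=> j; have [t [tc Vt]] := VJ j.
  have tcn (i : 'I_n) : (index (t i) c < size c)%N by rewrite index_mem; exact: tc.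
  exists (fun i => Ordinal (tcn i)) => i x; rewrite Vt => /(_ i (ltn_ord i)) /=.
  by rewrite nth_index//; exact: tc.
exists (size s), (fun j : 'I_(size s) => seqDU V j), kappa; split => //.
- by move=> j; apply: borelD; [exact: bV|apply: borel_bigsetU => k; exact: bV].
- move=> i j _ _ ij; apply/val_inj.
  exact: (@trivIset_seqDU _ V _ _ I I ij).
- rewrite -subTset => x _; have [U Us Ux] := sT x I.
  have : (\big[setU/set0]_(j < size s) seqDU V j) x.
    rewrite -bigsetU_seqDU -bigcup_mkord; exists (index U s) => /=.
      by rewrite index_mem.
    by rewrite /V nth_index.
  by rewrite -bigcup_mkord => -[j /= js Vj]; exists (Ordinal js).
- by move=> j i x [Vx _]; exact: kP.
Qed.

(** The preimage of [B] is enclosed in the union [PS] of the pieces whose colour meets [B]; as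
    colours have diameter below [e], [PS] stays in the preimage of the [e]-neighbourhood. The error
    [d] is paid once per colour. *)
Lemma bprob_le_of_masses (g : X -> X) (c : seq (set X)) (e d : R) m
    (P : 'I_m -> set X) (kappa : 'I_m -> 'I_(size c)) (mu nu : bprob R X) B :
  continuous g ->
  (forall U x y, U \in c -> U x -> U y -> mdist x y < e) ->
  (forall j, borel (P j)) -> trivIset setT P -> \bigcup_j P j = setT ->
  (forall j x, P j x -> nth set0 c (kappa j) (g x)) ->
  (forall r, \sum_j mu (P j) * (kappa j == r)%:R <=
             \sum_j nu (P j) * (kappa j == r)%:R + d) ->
  (size c)%:R * d <= e -> 0 <= d -> borel B ->
  mu (g @^-1` B) <= nu (g @^-1` eps_nbhd B e) + e.
Proof.
move=> cg dc bP tP PT kP mass de d0 bB.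
pose S : {set 'I_(size c)} :=
  finset (fun r : 'I_(size c) => `[< nth set0 c r `&` B !=set0 >]).
pose PS := \big[setU/set0]_(j | kappa j \in S) P j.
have bPS : borel PS by exact: borel_bigsetU.
have PSE (rho : bprob R X) :
    rho PS = \sum_(r in S) \sum_j rho (P j) * (kappa j == r)%:R.
  rewrite bprob_bigsetU ?index_enum_uniq// exchange_big/= big_mkcond/=.
  apply: eq_bigr => j _; rewrite -mulr_sumr.
  case: ifPn => [kS|kS].
    rewrite (bigD1 (kappa j))//= eqxx big1 ?addr0 ?mulr1// => r /andP[_].
    by rewrite eq_sym => /negbTE ->.
  rewrite big1 ?mulr0// => r rS; case: eqP => // kr.
  by move: kS; rewrite kr rS.
have sub1 : g @^-1` B `<=` PS.
  move=> x Bgx; have : [set: X] x by []; rewrite -PT => -[j _ Pjx].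
  rewrite /PS -bigcup_seq_cond; exists j => //=; rewrite mem_index_enum/= inE.
  by apply/asboolP; exists (g x); split => //; exact: kP.
have sub2 : PS `<=` g @^-1` eps_nbhd B e.
  rewrite /PS -bigcup_seq_cond => x [j /= /andP[_]]; rewrite inE.
  move=> /asboolP[y [cy By]] /kP cgx; exists y => //.
  by apply: dc cgx cy; rewrite mem_nth.
have bg U : borel U -> borel (g @^-1` U) by exact: continuous_borel_preimage.
have : mu (g @^-1` B) <= mu PS by apply: le_bprob => //; exact: bg.
have : nu PS <= nu (g @^-1` eps_nbhd B e).
  by apply: le_bprob => //; exact: bg (borel_eps_nbhd _ _).
suff : mu PS <= nu PS + e by lra.
rewrite !PSE; apply: (le_trans (ler_sum _ (fun r _ => mass r))).
rewrite big_split/= lerD2l sumr_const -mulr_natl (le_trans _ de)//.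
by rewrite ler_wpM2r// ler_nat (leq_trans (max_card _))// card_ord.
Qed.

End partitions.

Lemma hat_seq_entropy (R : realType) (X : metricType R) (hX : compact [set: X])
    (f : nat -> X -> X) (cf : forall n, continuous (f n)) (a : nat -> nat) :
  @seq_entropy R X open f a = 0%E ->
  @seq_entropy R (bprob R X) prohorov_open (hat_seq cf) a = 0%E.
Proof.
move=> /(seq_entropy_eq0P _ _ openT) h; apply/seq_entropy_eq0P.
  exact: prohorov_openT.
move=> C opC b b0; have [_ oC CT] := opC.
have [eps eps0 epsP] := prohorov_lebesgue_number hX oC CT.
have e0 : 0 < eps / 2 by rewrite divr_gt0.
have [c [oc dc cT]] := compact_small_cover hX e0.
pose q : R := (size c)%:R.
(* The rounding scale is such that the errors [2 / L] of all [q] colours add up to at most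
   [eps / 2]. *)
have [L L0 LP] : exists2 L, (0 < L)%N & q * (2 / L%:R) <= eps / 2.
  exists (Num.truncn (q * 2 / (eps / 2))).+1 => //.
  by rewrite mulrA ler_pdivrMr ?ltr0n// [leRHS]mulrC -ler_pdivrMr// ltW// truncnS_gt.
pose g : R := q * L.*2.+1%:R.
have g0 : 0 <= g by rewrite mulr_ge0.
(* The final exponent has four terms, each kept below [b / 4 * n]. This [z] settles the choice of
   correction values, since [expR z] exceeds [z]; then [k] settles the number of corrections, [b']
   the growth of [m ^ k], and a large [n] the constant [k]. *)
pose z := 4 * g / b.
have z0 : 0 <= z by rewrite divr_ge0 ?mulr_ge0// ltW.
have zP : g * expR (- z) <= b / 4.
  rewrite expRN ler_pdivrMr ?expR_gt0//.
  have -> : g = b / 4 * z by rewrite /z; field; exact: lt0r_neq0.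
  rewrite ler_wpM2l ?divr_ge0 ?ltW//.
  by rewrite (lt_le_trans _ (expR_ge1Dx z))// ltrDr.
pose v := z * (L%:R ^+ 2 * q).
have [k k0 kP] : exists2 k, (0 < k)%N & v / k%:R <= b / 4.
  exists (Num.truncn (v / (b / 4))).+1 => //.
  by rewrite ler_pdivrMr ?ltr0n// [leRHS]mulrC -ler_pdivrMr ?divr_gt0// ltW// truncnS_gt.
have k0R : 0 < k%:R :> R by rewrite ltr0n.
have opc : finite_open_cover open [set` c].
  split; [exact: finite_seq|exact: oc|].
  by rewrite -subTset => x _; have [U Uc Ux] := cT x; exists U.
pose b' := b / 4 / k%:R.
have b'0 : 0 < b' by rewrite !divr_gt0.
have [N NP] := h _ opc b' b'0.
exists (maxn N (Num.truncn (k%:R / (b / 4))).+1) => n.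
rewrite geq_max => /andP[Nn kn].
have knR : k%:R <= b / 4 * n%:R.
  rewrite [leRHS]mulrC -ler_pdivrMr ?divr_gt0// (le_trans (ltW (truncnS_gt _)))//.
  by rewrite ler_nat.
have [m [P [kappa [mN bP tP PT kappaP]]]] := join_partition cf a n oc cT.
pose e j (t : 'I_n * 'I_(size c)) : R := (kappa j t.1 == t.2)%:R.
pose w (mu : bprob R X) j := mu (P j).
have e01 j t : 0 <= e j t <= 1 by rewrite /e; case: eqP => _; rewrite ler0n lern1.
have sw mu : simplex (w mu).
  split=> [j|]; first exact: bp_ge0.
  rewrite /w -bprob_bigsetU ?index_enum_uniq// -bigcup_seq.
  rewrite (_ : \bigcup_(i in _) P i = setT) ?bp_setT// -PT.
  by apply: eq_bigcupl; split => j //= _; rewrite mem_index_enum.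
have [T [A [code [codeA codeP cardA]]]] := convex_coding e01 sw k0 L0 z0.
have [mu|s sJ sA] :=
    @subcover_of_coding _ (join_pre (hat_seq cf) a n C) T code A codeA.
  have /choice[U UP] (i : nat) : exists U, C U /\
      [set nu | prohorov (comp0n (hat_seq cf) (a i) mu) nu < eps] `<=` U.
    by have [U CU Ui] := epsP (comp0n (hat_seq cf) (a i) mu); exists U.
  exists (\bigcap_(i in [set i | (i < n)%N]) (comp0n (hat_seq cf) (a i) @^-1` U i)).
    by exists U; split => // i _; exact: (UP i).1.
  move=> nu /esym numu i /= ni; apply: (UP i).2 => /=.
  apply/prohorov_ltP; exists (eps / 2); split => //.
    by rewrite ltr_pdivrMr// ltr_pMr// ltr1n.
  move=> B bB; rewrite !comp0n_hat_seq//; last exact: borel_eps_nbhd.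
  apply: (@bprob_le_of_masses _ _ _ c _ (2 / L%:R) m P
    (fun j => kappa j (Ordinal ni))) => //.
  - exact: continuous_comp0n.
  - by move=> j x /(kappaP j (Ordinal ni)).
  - move=> r; have := codeP _ _ numu (Ordinal ni, r).
    by rewrite ler_norml /w /e /=; lra.
apply: (le_trans (Ncov_le_size sJ)).
have /le_trans : (size s)%:R <= #|A|%:R :> R by rewrite ler_nat.
apply; apply: (le_trans cardA).
(* The excess 1 of the near-minimal subcover costs at most a factor 2, which [expR 1] absorbs. *)
have mE : m%:R <= expR (1 + b' * n%:R).
  have E1 : 1 <= expR (b' * n%:R) by rewrite -expR0 ler_expR mulr_ge0// ltW.
  have E2 : 2 <= expR 1 :> R by apply: le_trans (expR_ge1Dx 1); lra.
  rewrite expRD; have : 2 * expR (b' * n%:R) <= expR 1 * expR (b' * n%:R).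
    by rewrite ler_wpM2r// expR_ge0.
  by have := NP n Nn; lra.
have : m%:R ^+ k <= expR (k%:R * (1 + b' * n%:R)).
  by rewrite expRM_natl lerXn2r ?nnegrE ?expR_ge0.
move=> /(ler_wpM2r (expR_ge0 _)) mk; apply: (le_trans (mk _)).
rewrite -expRD ler_expR.
rewrite card_prod !card_ord natrM -/q.
have -> : k%:R * (1 + b' * n%:R) = k%:R + b / 4 * n%:R.
  by rewrite /b'; field; exact: lt0r_neq0.
have -> : z * (L%:R ^+ 2 * (n%:R * q) / k%:R) = v / k%:R * n%:R.
  by rewrite /v; field; exact: lt0r_neq0.
have -> : n%:R * q * (L.*2.+1%:R * expR (- z)) = g * expR (- z) * n%:R.
  by rewrite /g; ring.
have : v / k%:R * n%:R <= b / 4 * n%:R by rewrite ler_wpM2r.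
have : g * expR (- z) * n%:R <= b / 4 * n%:R by rewrite ler_wpM2r.
lra.
Qed.

Theorem theorem5p3 (R : realType) (X : metricType R)
    (hX : compact [set: X])
    (f : nat -> X -> X) (cf : forall n, continuous (f n))
    (a : nat -> nat) (ha : strictly_increasing a) :
  (@seq_entropy R X open f a = 0%E <->
     @seq_entropy R (bprob R X) prohorov_open (hat_seq cf) a = 0%E) /\
  (@null_system R X open f <->
     @null_system R (bprob R X) prohorov_open (hat_seq cf)).
Proof.
have iff a' : @seq_entropy R X open f a' = 0%E <->
    @seq_entropy R (bprob R X) prohorov_open (hat_seq cf) a' = 0%E.
  by split; [exact: hat_seq_entropy|exact: seq_entropy_of_hat].
by split => //; split=> h a' /h/iff.
Qed.
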